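(* For every positive braid $\beta$, $-\widetilde{\sigma}(\beta)\geq \frac{1}{16}\, l(\beta)$.
   Context: Let $B_b$ be Artin's braid group on $b$ strands with standard generators $a_1,\dots,a_{b-1}$. A positive braid is an element of $B_b$ that can be written as a word using only positive powers of the generators; its length $l(\beta)$ is the number of letters in any such word. For a braid $\beta$, $\sigma(\beta)$ is the signature of the standard closure of $\beta$, where all strands are oriented in the same direction. The signature of a link is the signature of $A+A^T$ for a Seifert matrix $A$, with the sign convention that positive braids have negative signature; for example, $\sigma(a_1^n)=1-n$ for $n\ge1$. The map $\sigma$ is a quasi-morphism on $B_b$. The asymptotic signature is $\widetilde{\sigma}(\beta)=\lim_{i\to\infty}\sigma(\beta^i)/i$. *)

(* Defs.v *)
From HB Require Import structures.
From mathcomp Require Import all_boot all_order all_algebra.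
From Stdlib Require Import ClassicalEpsilon.
From Stdlib Require ZArith Reals.
Set Implicit Arguments.
Unset Strict Implicit.
Unset Printing Implicit Defensive.
Import Order.TTheory GRing.Theory Num.Theory.

(* Positive braid words.  A positive braid in B_b is represented by a word   *)
(* in the standard generators a_1, ..., a_{b-1}; the letter i stands for a_i.*)
Definition positive_braid_word (b : nat) (w : seq nat) : bool :=
  all (fun i => (0 < i) && (i < b)) w.

Definition braid_length (w : seq nat) : nat := size w.

Definition braid_pow (w : seq nat) (i : nat) : seq nat := flatten (nseq i w).

Local Open Scope ring_scope.
Definition pbool (P : Prop) : bool :=
  if excluded_middle_informative P then true else false.

Definition posdef_on (n k : nat) (S : 'M[rat]_n) (P : 'M[rat]_(k, n)) : Prop :=
  forall x : 'rV[rat]_k, x != 0 -> (0 < (x *m P *m S *m P^T *m x^T) ord0 ord0)%R.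

Definition pos_index (n : nat) (S : 'M[rat]_n) : nat :=
  \max_(k < n.+1 | pbool (exists P : 'M[rat]_(k, n), posdef_on S P)) k.

Definition mx_signature (n : nat) (S : 'M[rat]_n) : int :=
  ((pos_index S)%:Z - (pos_index (- S))%:Z)%R.

(* Seifert matrix of the closure of a positive braid word, computed from the *)
(* canonical Seifert surface (Seifert's algorithm on the closed braid: one   *)
(* disk per strand, one positively half-twisted band per letter).  A basis   *)
(* of H_1 of the surface is given by the cycles c_q, one for each position q *)
(* of the word having an earlier occurrence of the same letter; c_q runs     *)
(* through the band of the previous occurrence prevp q and the band q.       *)
(* We index rows/columns by all positions 0..l-1; rows and columns of        *)
(* positions without a cycle are zero (this does not change the signature).  *)
Local Close Scope ring_scope.
Definition has_prev (w : seq nat) (q : nat) : bool :=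
  has (fun p => nth 0 w p == nth 0 w q) (iota 0 q).

Definition prevp (w : seq nat) (q : nat) : nat :=
  last 0 [seq p <- iota 0 q | nth 0 w p == nth 0 w q].

Definition seifert_entry (w : seq nat) (x y : nat) : rat :=
  if has_prev w x && has_prev w y then
    let lx := nth 0 w x in let ly := nth 0 w y in
    let px := prevp w x in let py := prevp w y in
    if x == y then (-1)%R
    else if (lx == ly) && (py == x) then 1%R
    else if (ly == lx.+1) && [&& px < py, py < x & x < y] then 1%R
    else if (ly == lx.+1) && [&& py < px, px < y & y < x] then (-1)%R
    else 0%R
  else 0%R.

Definition seifert_matrix (w : seq nat) : 'M[rat]_(size w) :=
  \matrix_(i < size w, j < size w) seifert_entry w i j.

(* sigma(beta) = signature of A + A^T; with these conventions positive braids *)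
(* have negative signature, e.g. sigma(a_1^n) = 1 - n.                       *)
Definition braid_signature (w : seq nat) : int :=
  mx_signature (seifert_matrix w + (seifert_matrix w)^T)%R.

Import ZArith Reals.

Definition int_to_Z (z : int) : Z :=
  match z with
  | Posz n => Z.of_nat n
  | Negz n => (- Z.of_nat n.+1)%Z
  end.

Definition is_asymptotic_signature (w : seq nat) (L : R) : Prop :=
  Un_cv (fun n : nat => (IZR (int_to_Z (braid_signature (braid_pow w n.+1)))
                          / INR n.+1)%R) L.

(* Main.v *)
(* On vectors indexed by the letters of the word, put                           *)
(*   Q(z) = sum_a z_a^2 - 2 sum z_a z_b,                                        *)
(* the second sum over letters a = a_i occurring before b = a_(i+1).  Sending   *)
(* the cycle c_q to (previous occurrence of the letter of q) - q turns          *)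
(* -(A + A^T) into Q.  Call column i the set of all cycles in the generator a_i.*)
(* Fix k mod 4.  All cycles in the columns of parity other than that of k span  *)
(* a space on which Q is the identity form; there we add pairwise disjoint      *)
(* cycles q from columns congruent to k mod 4.  A column is then adjacent to at *)
(* most one column of added cycles, and completing squares shows that an added  *)
(* cycle contributes (2 - D_q) x_q^2, where D_q counts the letters of adjacent  *)
(* columns lying between the two ends of q.  Adding the cycles with D_q <= 1    *)
(* gives a negative definite subspace for A + A^T, those with D_q <= 2 give a   *)
(* negative semidefinite one.  Disjointness is ensured by fixing the parity of  *)
(* the occurrence number; summing over the 8 choices of k and of the parity,    *)
(* and using sum_q D_q <= 2 l and 2 ([D <= 1] + [D <= 2]) >= 3 - D, we obtain   *)
(*   - 16 sigma >= l - 19 b                                                     *)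
(* for every positive word of length l on b strands.  The positive indices of   *)
(* A + A^T and -(A + A^T) are superadditive in the word up to b, so the limit   *)
(* exists by Fekete's lemma.                                                    *)
Require Import Defs.
From mathcomp Require Import all_boot all_order all_algebra.
From mathcomp Require Import ring zify.
Set Implicit Arguments.
Unset Strict Implicit.
Unset Printing Implicit Defensive.
Import Order.TTheory GRing.Theory Num.Theory.

(** * Occurrences of letters in a word *)

(** Passing from cycles to letters factors [- (A + A^T)] as [B G B^T] ([seifert_sym_letter_mx]),
    where off the diagonal [G] only sees pairs of letters in adjacent columns. On the coordinate
    subspace of a [span_set], [quad_complete_square] leaves a sum of squares plus [(2 - D_q) x_q^2]
    for each added cycle, so threshold 1 bounds the positive index of [- (A + A^T)] from below and
    threshold 2 bounds that of [A + A^T] from above. A letter lies strictly inside at most one cycle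
    of each adjacent column, hence [D_q] sums to at most [2 l] ([sum_straddle_count]). Up to [O(b)],
    averaging over the 8 sets turns the two bounds into the surplus [(3 l - 2 l) / 16], which is the
    source of [1/16] ([signature_bound]). Applied to the powers of the word, the error [19 b]
    vanishes after division by the exponent. The limit exists because concatenation glues Seifert
    forms up to [b] dimensions ([pos_index_seifert_cat]), so [fekete] applies to both indices. *)

Lemma last_filter_iota (c : pred nat) q : has c (iota 0 q) ->
  let p := last 0 [seq r <- iota 0 q | c r] in
  [/\ p < q, c p & forall r, p < r < q -> ~~ c r].
Proof.
elim: q => [//|q IH]; rewrite -addn1 iotaD add0n cats1 has_rcons filter_rcons.
case: ifP => [cq _|cq /= /IH[lt cp cr]].
  by rewrite last_rcons addn1; split => // r; lia.
split=> [|//|r /andP[pr]]; first by rewrite addn1 ltnS ltnW.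
rewrite addn1 ltnS leq_eqVlt => /predU1P[->|rq]; first by rewrite cq.
by apply: cr; rewrite pr.
Qed.

Lemma prevpP w q : has_prev w q ->
  [/\ prevp w q < q, nth 0 w (prevp w q) = nth 0 w q
    & forall r, prevp w q < r < q -> nth 0 w r <> nth 0 w q].
Proof.
by move=> /last_filter_iota[lt /eqP e h]; split=> // r /h /eqP.
Qed.

Lemma has_prevP w q :
  reflect (exists2 p, p < q & nth 0 w p = nth 0 w q) (has_prev w q).
Proof.
apply: (iffP hasP) => [[p]|[p lt e]]; first by rewrite mem_iota => /andP[_ lt] /eqP; exists p.
by exists p; [rewrite mem_iota | apply/eqP].
Qed.

Lemma prevp_unique w q p : p < q -> nth 0 w p = nth 0 w q ->
  (forall r, p < r < q -> nth 0 w r <> nth 0 w q) -> prevp w q = p.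
Proof.
move=> pq e h; have hp : has_prev w q by apply/has_prevP; exists p.
have [lt e' h'] := prevpP hp.
case: (ltngtP (prevp w q) p) => // lt'.
  by case: (h' p); rewrite ?lt'.
by case: (h (prevp w q)); rewrite ?lt'.
Qed.

Lemma leq_prevp w q r : has_prev w r -> q < r -> nth 0 w q = nth 0 w r ->
  q <= prevp w r.
Proof.
move=> /prevpP[_ _ h] qr e; rewrite leqNgt; apply/negP => lt.
by case: (h q); rewrite ?lt.
Qed.

(* Made symmetric: whichever of a, b carries the smaller letter i comes before *)
(* the other, which carries i + 1.                                            *)
Definition ascending (w : seq nat) (a b : nat) : bool :=
  (nth 0 w b == (nth 0 w a).+1) && (a < b) ||
  (nth 0 w a == (nth 0 w b).+1) && (b < a).

(** Its parity alternates along a column ([occ_prevp]), so two cycles of one column with equal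
    parity share no band. *)
Definition occ (w : seq nat) (q : nat) : nat :=
  count (fun p => nth 0 w p == nth 0 w q) (iota 0 q).

Lemma occ_prevp w q : has_prev w q -> occ w q = (occ w (prevp w q)).+1.
Proof.
move=> /prevpP[lt e h]; rewrite /occ.
have -> : iota 0 q = iota 0 (prevp w q) ++ prevp w q :: iota (prevp w q).+1 (q - (prevp w q).+1).
  by rewrite -[in LHS](subnKC lt) -addn1 !iotaD -catA addn1 add0n.
rewrite count_cat /= e eqxx [X in _ + (_ + X)](_ : _ = 0) ?addn0 ?addn1 //.
apply/eqP; rewrite -leqn0 leqNgt -has_count; apply/negP => /hasP[r].
by rewrite mem_iota subnKC // => /h hr /eqP.
Qed.

(** These are the letters of adjacent columns that pair nontrivially with the cycle [q]; see
    [ascending_diff]. *)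
Definition straddles (w : seq nat) (q a : nat) : bool :=
  [&& has_prev w q, prevp w q < a, a < q &
      (nth 0 w q == (nth 0 w a).+1) || (nth 0 w a == (nth 0 w q).+1)].

Lemma prevp_interval_inj w q r a : has_prev w q -> has_prev w r ->
  nth 0 w q = nth 0 w r -> prevp w q < a <= q -> prevp w r < a <= r -> q = r.
Proof.
move=> hq hr e /andP[q1 q2] /andP[r1 r2]; case: (ltngtP q r) => // lt.
  have := leq_prevp hr lt e; lia.
have := leq_prevp hq lt (esym e); lia.
Qed.

Lemma prevp_inj w q r : has_prev w q -> has_prev w r ->
  nth 0 w q = nth 0 w r -> prevp w q = prevp w r -> q = r.
Proof.
move=> hq hr e ep; have [ltq _ _] := prevpP hq; have [ltr _ _] := prevpP hr.
apply: (@prevp_interval_inj _ _ _ (prevp w q).+1) => //; lia.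
Qed.

Definition straddle_count (w : seq nat) (q : nat) : nat :=
  \sum_(a < size w) straddles w q a.

(** The first alternative gives the columns on which the form is the identity in letter coordinates,
    the second the added disjoint cycles. Working modulo 4 keeps two columns of added cycles from
    having a common neighbour. *)
Definition span_set (w : seq nat) (k : nat) (par : bool) (d : nat) : {set 'I_(size w)} :=
  [set q : 'I_(size w) | has_prev w q && ((odd (nth 0 w q) != odd k) ||
    [&& nth 0 w q %% 4 == k, odd (occ w q) == par & straddle_count w q <= d])].

Definition first_occs (w : seq nat) : {set 'I_(size w)} :=
  [set q : 'I_(size w) | ~~ has_prev w q].

Lemma card_first_occs b w : positive_braid_word b w -> #|first_occs w| <= b.
Proof.
case: b => [|b] hw.
  (* With [b = 0] no letter is allowed, so the word is empty. *)
  suff -> : w = [::] by rewrite (leq_trans (max_card _)) ?card_ord.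
  by case: w hw => //= a w; rewrite andbF.
pose f (q : 'I_(size w)) : 'I_b.+1 := inord (nth 0 w q).
rewrite -(card_in_imset (f := f)) => [|q r]; first by rewrite -[X in _ <= X]card_ord max_card.
have fE s : val (f s) = nth 0 w s.
  by rewrite /f /= inordK //; have /andP[] := allP hw _ (mem_nth 0 (ltn_ord s)).
rewrite !inE => /has_prevP hq /has_prevP hr /(congr1 val); rewrite !fE => e.
apply/val_inj; case: (ltngtP (val q) (val r)) => // lt.
  by case: hr; exists q.
by case: hq; exists r.
Qed.

Lemma sum_bool_card (I : finType) (P : pred I) : \sum_i P i = #|P|.
Proof.
rewrite -sum1_card [RHS]big_mkcond; apply: eq_bigr => i _.
by rewrite unfold_in; case: (P i).
Qed.

(** Double counting: the intervals of the cycles of one column are disjoint, so a letter is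
    straddled at most once from the column above and once from the column below. *)
Lemma sum_straddle_count w :
  \sum_(q < size w) straddle_count w q <= 2 * size w.
Proof.
rewrite exchange_big /= mulnC -[X in X * 2]card_ord -sum_nat_const.
apply: leq_sum => a _.
pose P1 := [pred q : 'I_(size w) | straddles w q a & nth 0 w q == (nth 0 w a).+1].
pose P2 := [pred q : 'I_(size w) | straddles w q a & nth 0 w a == (nth 0 w q).+1].
apply: (@leq_trans (\sum_(q < size w) (P1 q + P2 q))).
  apply: leq_sum => q _; rewrite /P1 /P2 /=.
  case E: straddles => //=; case/and4P: E => _ _ _ /orP[] ->; lia.
have inj (P : pred 'I_(size w)) : (forall q, P q -> straddles w q a) ->
    (forall q r, P q -> P r -> nth 0 w q = nth 0 w r) -> \sum_(q < size w) P q <= 1.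
  move=> Ps Pe; rewrite sum_bool_card.
  apply/card_le1_eqP => q r Pq Pr; have e := Pe _ _ Pq Pr.
  have /and4P[hq q1 q2 _] := Ps _ Pq; have /and4P[hr r1 r2 _] := Ps _ Pr.
  apply: ord_inj; symmetry; apply: (prevp_interval_inj hq hr e (a := a)).
    by rewrite q1 ltnW.
  by rewrite r1 ltnW.
rewrite big_split; apply: (@leq_add _ _ 1 1); apply: inj.
- by move=> q /andP[].
- by move=> q r /andP[_ /eqP ->] /andP[_ /eqP ->].
- by move=> q /andP[].
- by move=> q r /andP[_ /eqP h] /andP[_ /eqP]; rewrite h => -[].
Qed.

(** The two values of [k] of the other parity contribute 8 memberships, and the one matching pair
    [(k, par)] contributes [[D <= 1] + [D <= 2]]. Doubling gives [16 + 3 - D] at least. *)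
Lemma span_set_count w (q : 'I_(size w)) : has_prev w q ->
  19 <= 2 * (\sum_(k < 4) \sum_(par : bool)
        ((q \in span_set w k par 1) + (q \in span_set w k par 2))) + straddle_count w q.
Proof.
move=> hq; rewrite !big_ord_recr big_ord0 /= !big_bool /= !inE hq /=.
have := odd_mod (nth 0 w q) (erefl : odd 4 = false).
have : nth 0 w q %% 4 < 4 by rewrite ltn_mod.
move: (nth 0 w q %% 4) => [|[|[|[|//]]]] _ /= <-; case: (odd (occ w q)) => /=;
  by case: (leqP (straddle_count w q) 1); case: (leqP (straddle_count w q) 2) => /=; lia.
Qed.

(** * Previous occurrences in a concatenated word *)

Section ConcatPrev.
Variables v1 v2 : seq nat.

Lemma nth_catl q : q < size v1 -> nth 0 (v1 ++ v2) q = nth 0 v1 q.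
Proof. by move=> lt; rewrite nth_cat lt. Qed.

Lemma nth_catr q : nth 0 (v1 ++ v2) (size v1 + q) = nth 0 v2 q.
Proof. by rewrite nth_cat ltnNge leq_addr addKn. Qed.

Lemma nth_eq_catl q : q < size v1 ->
  {in iota 0 q, (fun p => nth 0 (v1 ++ v2) p == nth 0 (v1 ++ v2) q)
     =1 (fun p => nth 0 v1 p == nth 0 v1 q)}.
Proof.
move=> lt p; rewrite mem_iota => /andP[_ pq].
by rewrite !nth_catl // (ltn_trans pq).
Qed.

Lemma has_prev_catl q : q < size v1 -> has_prev (v1 ++ v2) q = has_prev v1 q.
Proof. by move=> lt; apply: eq_in_has; apply: nth_eq_catl. Qed.

Lemma prevp_catl q : q < size v1 -> prevp (v1 ++ v2) q = prevp v1 q.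
Proof. by move=> lt; rewrite /prevp (eq_in_filter (nth_eq_catl lt)). Qed.

Lemma prevp_catr q : has_prev v2 q -> prevp (v1 ++ v2) (size v1 + q) = size v1 + prevp v2 q.
Proof.
move=> /prevpP[lt e h]; apply: prevp_unique; rewrite ?nth_catr ?ltn_add2l // => r hr.
have -> : r = size v1 + (r - size v1) by lia.
by rewrite nth_catr; apply: h; lia.
Qed.

Lemma has_prev_catr q : has_prev v2 q -> has_prev (v1 ++ v2) (size v1 + q).
Proof.
move=> /has_prevP[p lt e]; apply/has_prevP; exists (size v1 + p).
  by rewrite ltn_add2l.
by rewrite !nth_catr.
Qed.

End ConcatPrev.

Lemma size_braid_pow w n : size (braid_pow w n) = n * size w.
Proof. by elim: n => //= n IH; rewrite /braid_pow /= size_cat IH. Qed.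

Lemma braid_powD w m n : braid_pow w (m + n) = braid_pow w m ++ braid_pow w n.
Proof. by rewrite /braid_pow nseqD flatten_cat. Qed.

Lemma positive_braid_pow b w n :
  positive_braid_word b w -> positive_braid_word b (braid_pow w n).
Proof.
move=> hw; elim: n => //= n IH.
by rewrite /braid_pow /= /positive_braid_word all_cat; apply/andP; split.
Qed.

Local Open Scope ring_scope.

(** * Positive index of a symmetric form *)

Definition quad (n : nat) (S : 'M[rat]_n) (x : 'rV[rat]_n) : rat :=
  (x *m S *m x^T) ord0 ord0.

Lemma quadE n (S : 'M[rat]_n) x :
  quad S x = \sum_i \sum_j x ord0 i * S i j * x ord0 j.
Proof.
rewrite /quad mxE exchange_big; apply: eq_bigr => j _ /=.
by rewrite !mxE mulr_suml.
Qed.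

Lemma posdef_quad n k (S : 'M[rat]_n) (P : 'M[rat]_(k, n)) :
  posdef_on S P <-> forall x, x != 0 -> 0 < quad S (x *m P).
Proof. by split=> h x /h; rewrite /quad trmx_mul !mulmxA. Qed.

Lemma pboolP P : reflect P (pbool P).
Proof.
by rewrite /pbool; case: ClassicalEpsilon.excluded_middle_informative => h; constructor.
Qed.

Lemma row_free_kernel k n (P : 'M[rat]_(k, n)) :
  (forall x : 'rV_k, x *m P = 0 -> x = 0) -> row_free P.
Proof.
move=> h; rewrite -kermx_eq0; apply/eqP/row_matrixP => i; rewrite row0.
by apply: h; rewrite -row_mul mulmx_ker row0.
Qed.

Lemma posdef_leq n k (S : 'M[rat]_n) (P : 'M[rat]_(k, n)) :
  posdef_on S P -> (k <= n)%N.
Proof.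
move=> /posdef_quad h; have /eqP <- : row_free P.
  apply: row_free_kernel => x xP0; apply/eqP; apply/negPn/negP => /h.
  by rewrite xP0 /quad !mul0mx mxE ltxx.
exact: rank_leq_col.
Qed.

Lemma posdef_leq_pos_index n k (S : 'M[rat]_n) (P : 'M[rat]_(k, n)) :
  posdef_on S P -> (k <= pos_index S)%N.
Proof.
move=> h; have kn : (k < n.+1)%N by rewrite ltnS (posdef_leq h).
apply: (@leq_bigmax_cond _ (fun k : 'I_n.+1 => pbool (exists P : 'M[rat]_(k, n), posdef_on S P))
  (fun k => k : nat) (Ordinal kn)).
by apply/pboolP; exists P.
Qed.

Lemma pos_index_attained n (S : 'M[rat]_n) :
  exists P : 'M[rat]_(pos_index S, n), posdef_on S P.
Proof.
pose A := [pred k : 'I_n.+1 | pbool (exists P : 'M[rat]_(k, n), posdef_on S P)].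
have A0 : (0 < #|A|)%N.
  apply/card_gt0P; exists ord0; apply/pboolP; exists 0 => x /eqP[].
  by apply/rowP => -[].
have [i iA e] := eq_bigmax_cond (fun k : 'I_n.+1 => k : nat) A0.
have -> : pos_index S = i by exact: e.
exact/pboolP.
Qed.

Lemma pos_index_leq n (S : 'M[rat]_n) : (pos_index S <= n)%N.
Proof. by have [P /posdef_leq] := pos_index_attained S. Qed.

(** Vanishing on [F] imposes [#|F|] linear equations on the row space; [R] is a basis of the kernel
    of the columns of [P] indexed by [F]. *)
Lemma rows_vanishing_on n k (P : 'M[rat]_(k, n)) (F : {set 'I_n}) :
  exists k' (R : 'M[rat]_(k', k)), [/\ (k <= k' + #|F|)%N, row_free R &
    forall i j, j \in F -> (R *m P) i j = 0].
Proof.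
pose A := colsub (fun i : 'I_#|F| => enum_val i) P.
exists _, (row_base (kermx A)); split; last 1 first.
- move=> i j jF; have /submxP[B ->] : (row_base (kermx A) <= kermx A)%MS.
    by rewrite eq_row_base.
  have -> : (B *m kermx A *m P) i j
          = (B *m kermx A *m A) i (enum_rank_in jF j).
    by rewrite !mxE; apply: eq_bigr => l _; rewrite !mxE enum_rankK_in.
  by rewrite -mulmxA mulmx_ker mulmx0 mxE.
- by rewrite mxrank_ker -leq_subLR; have := rank_leq_col A; lia.
- exact: row_base_free.
Qed.

Lemma row_free_mul_neq0 k n (R : 'M[rat]_(k, n)) (x : 'rV_k) :
  row_free R -> x != 0 -> x *m R != 0.
Proof.
by move=> fR; apply: contraNN => /eqP xR; apply/eqP/(row_free_inj fR); rewrite mul0mx.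
Qed.

(** A positive definite subspace meets the coordinate subspace of [K], where the form is
    nonpositive, only in 0, so their dimensions add up to at most [n]. *)
Lemma pos_index_leq_nonpos_coord n (S : 'M[rat]_n) (K : {set 'I_n}) :
  (forall x : 'rV_n, (forall j, j \notin K -> x ord0 j = 0) -> quad S x <= 0) ->
  (pos_index S + #|K| <= n)%N.
Proof.
move=> hK; have [P /posdef_quad hP] := pos_index_attained S.
have [k' [R [le fR RF]]] := rows_vanishing_on P (~: K).
suff k0 : k' = 0%N.
  by have := cardsC K; rewrite card_ord; rewrite k0 in le; lia.
apply/eqP; rewrite -leqn0 leqNgt; apply/negP => k'0.
pose x : 'rV[rat]_k' := delta_mx 0 (Ordinal k'0).
have x0 : x != 0.
  by apply/eqP => /rowP/(_ (Ordinal k'0)); rewrite !mxE !eqxx => /eqP; rewrite oner_eq0.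
have := hP _ (row_free_mul_neq0 fR x0); rewrite ltNge hK // => j jK.
rewrite -mulmxA mxE big1 // => i _; rewrite RF ?mulr0 //.
by rewrite inE.
Qed.

Lemma pos_index_geq_pos_coord n (S : 'M[rat]_n) (K : {set 'I_n}) :
  (forall x : 'rV_n, (forall j, j \notin K -> x ord0 j = 0) -> x != 0 -> 0 < quad S x) ->
  (#|K| <= pos_index S)%N.
Proof.
move=> hK; pose P : 'M[rat]_(#|K|, n) := \matrix_(i, j) (enum_val i == j)%:R.
apply: (@posdef_leq_pos_index _ _ _ P); apply/posdef_quad => x x0.
have xP (i : 'I_#|K|) : (x *m P) ord0 (enum_val i) = x ord0 i.
  rewrite mxE (bigD1 i) //= mxE eqxx mulr1 big1 ?addr0 // => j ji.
  by rewrite mxE (inj_eq enum_val_inj) (negPf ji) mulr0.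
apply: hK.
- move=> j jK; rewrite mxE big1 // => i _; rewrite mxE.
  by case: eqP => [e|_]; [rewrite -e enum_valP in jK | rewrite mulr0].
- apply: contraNneq x0 => xP0; apply/eqP/rowP => i.
  by rewrite -xP xP0 !mxE.
Qed.

(** Cutting an optimal subspace for [S2] by the equations [v_j = 0], [j] in [F], costs at most
    [#|F|] dimensions and makes its image orthogonal for [S] to that of an optimal subspace for
    [S1]. *)
Lemma pos_index_glue n1 n2 n (S1 : 'M[rat]_n1) (S2 : 'M[rat]_n2) (S : 'M[rat]_n)
    (f1 : 'I_n1 -> 'I_n) (f2 : 'I_n2 -> 'I_n) (F : {set 'I_n2}) :
  (forall i j, S (f1 i) (f1 j) = S1 i j) ->
  (forall i j, i \notin F -> j \notin F -> S (f2 i) (f2 j) = S2 i j) ->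
  (forall i j, j \notin F -> S (f1 i) (f2 j) = 0 /\ S (f2 j) (f1 i) = 0) ->
  (pos_index S1 + pos_index S2 <= pos_index S + #|F|)%N.
Proof.
move=> h1 h2 h12.
have [P1 /posdef_quad hP1] := pos_index_attained S1.
have [P2 /posdef_quad hP2] := pos_index_attained S2.
have [k' [R [le fR RF]]] := rows_vanishing_on P2 F.
pose E1 := \matrix_(i, j) (f1 i == j)%:R : 'M[rat]_(n1, n).
pose E2 := \matrix_(i, j) (f2 i == j)%:R : 'M[rat]_(n2, n).
have sel m m' (g : 'I_m -> 'I_n) (g' : 'I_m' -> 'I_n) :
    (\matrix_(i, j) (g i == j)%:R : 'M[rat]_(m, n)) *m S *m
    (\matrix_(i, j) (g' i == j)%:R : 'M[rat]_(m', n))^T = \matrix_(i, j) S (g i) (g' j).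
  apply/matrixP => i j; rewrite !mxE (bigD1 (g' j)) //= !mxE eqxx mulr1.
  rewrite (bigD1 (g i)) //= !mxE eqxx mul1r !big1 ?addr0 // => l nl;
    by rewrite !mxE [_ == l]eq_sym (negPf nl) ?mul0r ?mulr0.
have quadD (u : 'rV_n1) (v : 'rV_n2) : (forall j, j \in F -> v ord0 j = 0) ->
    quad S (u *m E1 + v *m E2) = quad S1 u + quad S2 v.
  move=> vF.
  rewrite /quad linearD /= !trmx_mul mulmxDl mulmxDr !mulmxDl.
  have c m m' (g : 'I_m -> 'I_n) (g' : 'I_m' -> 'I_n) y y' :
    (y *m (\matrix_(i, j) (g i == j)%:R : 'M[rat]_(m, n)) *m S *m
    ((\matrix_(i, j) (g' i == j)%:R : 'M[rat]_(m', n))^T *m y'^T)) =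
    y *m (\matrix_(i, j) S (g i) (g' j)) *m y'^T.
    by rewrite -sel !mulmxA.
  rewrite /E1 /E2 !c.
  have -> : \matrix_(i, j) S (f1 i) (f1 j) = S1.
    by apply/matrixP => i j; rewrite mxE h1.
  have -> : u *m (\matrix_(i, j) S (f1 i) (f2 j)) *m v^T = 0.
    rewrite -mulmxA [X in u *m X](_ : _ = 0) ?mulmx0 //.
    apply/matrixP => i j; rewrite [j]ord1 !mxE big1 // => l _; rewrite !mxE.
    have [lF|lF] := boolP (l \in F); first by rewrite vF ?mulr0.
    by rewrite (h12 _ _ lF).1 mul0r.
  have -> : v *m (\matrix_(i, j) S (f2 i) (f1 j)) *m u^T = 0.
    rewrite [X in X *m _](_ : _ = 0) ?mul0mx //.
    apply/matrixP => i j; rewrite [i]ord1 !mxE big1 // => l _; rewrite !mxE.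
    have [lF|lF] := boolP (l \in F); first by rewrite vF ?mul0r.
    by rewrite (h12 _ _ lF).2 mulr0.
  have -> : v *m (\matrix_(i, j) S (f2 i) (f2 j)) *m v^T = v *m S2 *m v^T.
    apply/matrixP => a c'; rewrite [a]ord1 [c']ord1 !mxE; apply: eq_bigr => j _.
    have [jF|jF] := boolP (j \in F); first by rewrite !mxE vF ?mulr0.
    congr (_ * _); rewrite !mxE; apply: eq_bigr => i _.
    have [iF|iF] := boolP (i \in F); first by rewrite vF ?mul0r.
    by rewrite mxE h2.
  by rewrite add0r addr0 mxE.
suff h : posdef_on S (col_mx (P1 *m E1) (R *m P2 *m E2)).
  have := posdef_leq_pos_index h; lia.
apply/posdef_quad => x x0.
rewrite -[x]hsubmxK mul_row_col !mulmxA.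
set u := lsubmx x *m P1; set v := rsubmx x *m R *m P2.
have vF j : j \in F -> v ord0 j = 0.
  move=> jF; rewrite /v -mulmxA mxE big1 // => i _; by rewrite RF ?mulr0.
rewrite quadD //.
have quad0 m (T : 'M[rat]_m) : quad T 0 = 0 by rewrite /quad !mul0mx mxE.
have [u0|u0] := eqVneq (lsubmx x) 0; last first.
  apply: ltr_wpDr; last exact: hP1.
  have [v0|v0] := eqVneq (rsubmx x) 0; first by rewrite /v v0 !mul0mx quad0.
  by apply/ltW/hP2/row_free_mul_neq0.
rewrite /u u0 mul0mx quad0 add0r; apply/hP2/row_free_mul_neq0 => //.
by apply: contraNneq x0 => v0; rewrite -[x]hsubmxK u0 v0 row_mx0.
Qed.

(** * The Seifert form on letter vectors *)

Lemma ascending_sym w a b : ascending w a b = ascending w b a.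
Proof. exact: orbC. Qed.

Lemma ascending0 w a b : nth 0%N w b != (nth 0%N w a).+1 ->
  nth 0%N w a != (nth 0%N w b).+1 -> ascending w a b = false.
Proof. by rewrite /ascending => /negPf -> /negPf ->. Qed.

Lemma ascendingS w a b : nth 0%N w b = (nth 0%N w a).+1 ->
  ascending w a b = (a < b)%N.
Proof.
rewrite /ascending => ->; rewrite eqxx orb_idr //= => /andP[/eqP]; lia.
Qed.

Definition letter_gram w q r : rat :=
  (q == r)%:R - (ascending w q r)%:R.

(** In one column only shared bands count. If [r] lies one column above [q], the right side is the
    indicator that [prevp w q] lies between the ends of [r] minus the same indicator for [q], so
    nested and disjoint pairs cancel and interleaved ones give a sign. *)
Lemma seifert_entry_sym w q r : has_prev w q -> has_prev w r ->
  - (seifert_entry w q r + seifert_entry w r q) =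
  (letter_gram w (prevp w q) (prevp w r) - letter_gram w (prevp w q) r) -
  (letter_gram w q (prevp w r) - letter_gram w q r).
Proof.
wlog: q r / (nth 0 w q <= nth 0 w r)%N => [hw hq hr|le hq hr].
  have [/hw->//|/ltnW/hw h] := leqP (nth 0 w q) (nth 0 w r).
  rewrite addrC h // /letter_gram ![ascending w _ q]ascending_sym.
  rewrite ![ascending w _ (prevp w q)]ascending_sym.
  rewrite ![_ == q]eq_sym ![_ == prevp w q]eq_sym; ring.
have [ltq eq hq'] := prevpP hq; have [ltr er hr'] := prevpP hr.
rewrite /seifert_entry hq hr /= /letter_gram.
move: le; rewrite leq_eqVlt => /predU1P[e|lt].
  rewrite !ascending0 ?eq ?er -?e ?eqxx ?(gtn_eqF (ltnSn _)) ?(ltn_eqF (ltnSn _)) //=.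
  have [E|E|E] := ltngtP q r.
  - have := leq_prevp hr E e => E'.
    have -> : (prevp w q == prevp w r) = false by lia.
    have -> : (prevp w q == r) = false by lia.
    by rewrite [q == _]eq_sym; case: eqP => _ /=; rewrite ?mulr0n ?mulr1n; ring.
  - have := leq_prevp hq E (esym e) => E'.
    have -> : (prevp w q == prevp w r) = false by lia.
    have -> : (q == prevp w r) = false by lia.
    have -> : (prevp w r == q) = false by lia.
    by case: eqP => _ /=; rewrite ?mulr0n ?mulr1n; ring.
  - rewrite E !eqxx !(ltn_eqF ltr) !(gtn_eqF ltr); rewrite ?mulr0n ?mulr1n; ring.
have ne : q != r by apply: contraTneq lt => ->; rewrite ltnn.
have ne1 : prevp w q != r by apply: contraTneq lt => E; rewrite -eq E ltnn.
have ne2 : q != prevp w r by apply: contraTneq lt => E; rewrite -er E ltnn.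
have ne3 : prevp w q != prevp w r by apply: contraTneq lt => E; rewrite -er -eq E ltnn.
rewrite eq_sym.
rewrite (negPf ne1) (negPf ne2) (negPf ne3) [r == q]eq_sym (negPf ne).
rewrite (gtn_eqF lt) (ltn_eqF lt) /=.
rewrite [nth 0 w q == _](ltn_eqF (ltnW _)) //=.
have [e|e] := eqVneq (nth 0%N w r) (nth 0%N w q).+1; last first.
  rewrite !ascending0 ?eq ?er // ?(ltn_eqF (ltnW _)) //=; rewrite ?mulr0n ?mulr1n; ring.
rewrite !ascendingS ?eq ?er //=.
move: ne ne1 ne2 ne3 ltq ltr.
case: (ltngtP (prevp w q) (prevp w r)) => //; case: (ltngtP (prevp w q) r) => //;
case: (ltngtP q (prevp w r)) => //; case: (ltngtP q r) => // *; try lia; rewrite /=; rewrite ?mulr0n ?mulr1n; ring.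
Qed.

(** Moving from one end of the cycle to the other changes the order relative to [a] exactly when [a]
    lies in between; the square removes a sign that depends on the side of the adjacent column. *)
Lemma ascending_diff w q a : has_prev w q ->
  ((ascending w a (prevp w q))%:R - (ascending w a q)%:R) ^+ 2
  = (straddles w q a)%:R :> rat.
Proof.
move=> hq; have [lt e h] := prevpP hq; rewrite /straddles hq /=.
have [E|E] := eqVneq (nth 0%N w q) (nth 0%N w a).+1.
  rewrite !ascendingS ?e // orTb andbT.
  have ne : prevp w q != a by apply/eqP => E'; rewrite -E' -e in E; lia.
  have ne' : q != a by apply/eqP => E'; rewrite -E' in E; lia.
  move: ne ne' lt; case: (ltngtP (prevp w q) a) => //; case: (ltngtP a q) => //= *; try lia;
    by rewrite ?(mulr0n, mulr1n, subr0, sub0r, subrr, sqrrN, expr0n, expr1n).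
have [E'|E'] := eqVneq (nth 0%N w a) (nth 0%N w q).+1.
  rewrite ![ascending w a _]ascending_sym !ascendingS ?e // andbT.
  have ne : prevp w q != a by apply/eqP => E''; rewrite -E'' in E'; lia.
  have ne' : q != a by apply/eqP => E''; rewrite -E'' in E'; lia.
  move: ne ne' lt; case: (ltngtP (prevp w q) a) => //; case: (ltngtP a q) => //= *; try lia;
    by rewrite ?(mulr0n, mulr1n, subr0, sub0r, subrr, sqrrN, expr0n, expr1n).
rewrite !ascending0 ?e // !andbF subrr expr0n //.
Qed.

(** * Change of coordinates from cycles to letters *)

Section Brick.
Variable w : seq nat.

Definition prev_ord (q : 'I_(size w)) : 'I_(size w) := insubd q (prevp w q).

Lemma val_prev_ord (q : 'I_(size w)) : has_prev w q -> val (prev_ord q) = prevp w q.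
Proof.
move=> /prevpP[lt _ _]; rewrite /prev_ord val_insubd.
by rewrite (ltn_trans lt (ltn_ord q)).
Qed.

Definition brick_mx : 'M[rat]_(size w) :=
  \matrix_(q, a) if has_prev w q then (prev_ord q == a)%:R - (q == a)%:R else 0.

Definition letter_mx : 'M[rat]_(size w) :=
  \matrix_(a, b) letter_gram w a b.

Lemma sum_pick (m : nat) (i : 'I_m) (g : 'I_m -> rat) :
  \sum_j (i == j)%:R * g j = g i.
Proof.
rewrite (bigD1 i) //= eqxx mul1r big1 ?addr0 // => j /negPf ji.
by rewrite eq_sym ji mul0r.
Qed.

Lemma sum_brick q (g : 'I_(size w) -> rat) :
  \sum_a brick_mx q a * g a = if has_prev w q then g (prev_ord q) - g q else 0.
Proof.
case: ifP => hq; last by rewrite big1 // => a _; rewrite mxE hq mul0r.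
rewrite -(sum_pick (prev_ord q)) -(sum_pick q g) -sumrB.
by apply: eq_bigr => a _; rewrite mxE hq mulrBl.
Qed.

Lemma seifert_sym_letter_mx :
  - (seifert_matrix w + (seifert_matrix w)^T) = brick_mx *m letter_mx *m brick_mx^T.
Proof.
apply/matrixP => q r; rewrite -mulmxA [RHS]mxE sum_brick.
rewrite ![in LHS]mxE.
have mE a : (letter_mx *m brick_mx^T) a r =
    if has_prev w r then letter_gram w a (prev_ord r) - letter_gram w a r else 0.
  rewrite mxE -[RHS](sum_brick r (fun b : 'I__ => letter_gram w a b)).
  by apply: eq_bigr => b _; rewrite !mxE mulrC.
have [hq|hq] := boolP (has_prev w q); last first.
  by rewrite /seifert_entry (negPf hq) andbF addr0 oppr0.
rewrite !mE; have [hr|hr] := boolP (has_prev w r); last first.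
  by rewrite /seifert_entry (negPf hr) andbF /= !(addr0, oppr0).
by rewrite seifert_entry_sym // !val_prev_ord.
Qed.

Definition letter_vec (x : 'rV[rat]_(size w)) := x *m brick_mx.

Lemma quad_letter_vec x :
  quad (- (seifert_matrix w + (seifert_matrix w)^T)) x =
  \sum_a (letter_vec x 0 a) ^+ 2
  - \sum_(a < size w) \sum_(b < size w) letter_vec x 0 a * (ascending w a b)%:R * letter_vec x 0 b.
Proof.
rewrite seifert_sym_letter_mx /quad -!mulmxA -trmx_mul !mulmxA.
rewrite -/(quad letter_mx (x *m brick_mx)) quadE -sumrB; apply: eq_bigr => a _.
rewrite -/(letter_vec x) -[X in X - _](sum_pick a (fun b => letter_vec x 0 a * letter_vec x 0 b)) -sumrB.
apply: eq_bigr => b _; rewrite [letter_mx a b]mxE /letter_gram.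
rewrite -val_eqE /=; ring.
Qed.

End Brick.

Lemma sqr_sum_orth (I : finType) (P : pred I) (f : I -> rat) :
  (forall i j, P i -> P j -> i != j -> f i * f j = 0) ->
  (\sum_(i | P i) f i) ^+ 2 = \sum_(i | P i) f i ^+ 2.
Proof.
move=> h; rewrite expr2 big_distrlr /=; apply: eq_bigr => i Pi.
rewrite (bigD1 i) //= big1 ?addr0 // => j /andP[Pj ji].
by rewrite h // eq_sym.
Qed.

Lemma brick_mx_letter w (q a : 'I_(size w)) : nth 0%N w q != nth 0%N w a -> brick_mx w q a = 0.
Proof.
rewrite mxE; case: ifP => // hq ne; have [_ e _] := prevpP hq.
rewrite -!val_eqE /= val_prev_ord //.
case: eqP => [E|_]; first by rewrite -E e eqxx in ne.
by case: eqP => [E|_]; rewrite ?subrr // E eqxx in ne *.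
Qed.

(** * Completing squares on the span of a [span_set] *)

Section Square.
Variables (w : seq nat) (k : nat) (par : bool) (d : nat) (x : 'rV[rat]_(size w)).
Hypothesis k4 : (k < 4)%N.
Hypothesis xsupp : forall q, q \notin span_set w k par d -> x 0 q = 0.

Let J := [pred q : 'I_(size w) | (nth 0 w q %% 4 == k)%N].
Let base a := \sum_(q | ~~ J q) x 0 q * brick_mx w q a.
Let extra a := \sum_(q | J q) x 0 q * brick_mx w q a.
Let linked (a b : 'I_(size w)) : rat := (ascending w a b)%:R.
Let shift a := \sum_b linked a b * extra b.

Lemma span_setJ (q : 'I_(size w)) : J q -> x 0 q != 0 ->
  [/\ has_prev w q, odd (occ w q) = par & (straddle_count w q <= d)%N].
Proof.
move=> /eqP Jq xq; have : q \in span_set w k par d.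
  by apply: contraNT xq => /xsupp ->.
rewrite inE => /andP[hq /orP[|/and3P[_ /eqP-> ->]]] //.
by rewrite -Jq odd_mod // eqxx.
Qed.

Lemma span_setNJ (q : 'I_(size w)) : ~~ J q -> x 0 q != 0 -> odd (nth 0%N w q) != odd k.
Proof.
move=> /negPf /= Jq xq; have : q \in span_set w k par d.
  by apply: contraNT xq => /xsupp ->.
by rewrite inE Jq orbF => /andP[].
Qed.

Lemma base_supp (a : 'I_(size w)) : odd (nth 0%N w a) = odd k -> base a = 0.
Proof.
move=> ha; rewrite /base big1 // => q Jq; have [->|xq] := eqVneq (x 0 q) 0; first by rewrite mul0r.
rewrite brick_mx_letter ?mulr0 //; apply: contraNneq (span_setNJ Jq xq) => ->.
by rewrite ha.
Qed.

Lemma extra_supp (a : 'I_(size w)) : (nth 0 w a %% 4 != k)%N -> extra a = 0.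
Proof.
move=> ha; rewrite /extra big1 // => q /eqP Jq.
by rewrite brick_mx_letter ?mulr0 //; apply: contraNneq ha => <-; apply/eqP.
Qed.

Lemma extra_supp_odd (a : 'I_(size w)) : odd (nth 0%N w a) != odd k -> extra a = 0.
Proof.
move=> h; apply: extra_supp; apply: contraNneq h => <-.
by rewrite odd_mod.
Qed.

Lemma linked_parity (a b : 'I_(size w)) : odd (nth 0%N w a) = odd (nth 0%N w b) -> linked a b = 0.
Proof.
move=> h; rewrite /linked ascending0 //; apply: contraTneq isT => e; exfalso; move: h.
  by rewrite e /=; case: odd.
by rewrite e /=; case: odd.
Qed.

Lemma letter_vecE a : letter_vec x 0 a = base a + extra a.
Proof. by rewrite mxE (bigID J) /= addrC. Qed.

Lemma letter_vec_cross : \sum_a \sum_b letter_vec x 0 a * linked a b * letter_vec x 0 b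
  = \sum_a 2 * (base a * shift a).
Proof.
have e : \sum_a base a * shift a = \sum_a \sum_b extra a * linked a b * base b.
  rewrite exchange_big; apply: eq_bigr => a _; rewrite mulr_sumr.
  by apply: eq_bigr => b _; rewrite /linked ascending_sym; ring.
rewrite -mulr_sumr mulr2n mulrDl mul1r {2}e -big_split; apply: eq_bigr => a _ /=.
rewrite mulr_sumr -big_split; apply: eq_bigr => b _ /=.
rewrite !letter_vecE.
have [ha|ha] := eqVneq (odd (nth 0%N w a)) (odd k);
have [hb|hb] := eqVneq (odd (nth 0%N w b)) (odd k).
- by rewrite linked_parity ?ha ?hb //; ring.
- by rewrite (base_supp ha) (extra_supp_odd hb); ring.
- by rewrite (base_supp hb) (extra_supp_odd ha); ring.
- rewrite linked_parity; first by ring.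
  by move: ha hb; do 3 case: odd.
Qed.

(** The added cycles are disjoint, so no cross terms appear, and each has coefficients 1 and -1 at
    its two ends. *)
Lemma sum_extra_sqr : \sum_a extra a ^+ 2 = \sum_(q | J q) 2 * x 0 q ^+ 2.
Proof.
transitivity (\sum_a \sum_(q | J q) (x 0 q * brick_mx w q a) ^+ 2).
  apply: eq_bigr => a _; apply: sqr_sum_orth => q r Jq Jr qr.
  have [->|xq] := eqVneq (x 0 q) 0; first by rewrite !mul0r.
  have [->|xr] := eqVneq (x 0 r) 0; first by rewrite !(mul0r, mulr0).
  have [ha|ha] := eqVneq (nth 0%N w q) (nth 0%N w a); last first.
    by rewrite brick_mx_letter // mulr0 mul0r.
  have [hb|hb] := eqVneq (nth 0%N w r) (nth 0%N w a); last first.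
    by rewrite mulrC brick_mx_letter // mulr0 mul0r.
  have [hq oq _] := span_setJ Jq xq; have [hr or _] := span_setJ Jr xr.
  rewrite !mxE hq hr -!val_eqE /= !val_prev_ord //.
  have eqr : nth 0%N w q = nth 0%N w r by rewrite ha hb.
  have := qr; rewrite -val_eqE /=.
  have N1 : prevp w q = r -> False.
    by move=> e; move: oq; rewrite occ_prevp // e /= or; case: par.
  have N2 : prevp w r = q -> False.
    by move=> e; move: or; rewrite occ_prevp // e /= oq; case: par.
  have N3 : prevp w q = prevp w r -> False.
    by move=> /(prevp_inj hq hr eqr) /val_inj e; rewrite e eqxx in qr.
  case: (prevp w q =P a) => [E1|_]; case: (prevp w r =P a) => [E2|_];
  case: (nat_of_ord q =P a) => [E3|_]; case: (nat_of_ord r =P a) => [E4|_] => qr';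
  try (by rewrite ?(subrr, subr0, mul0r, mulr0)); exfalso;
  first [by apply: N1; congruence | by apply: N2; congruence | by apply: N3; congruence
        | by rewrite -E3 in E4; rewrite E4 eqxx in qr'].
rewrite exchange_big; apply: eq_bigr => q Jq /=.
have [->|xq] := eqVneq (x 0 q) 0.
  by rewrite expr0n mulr0 big1 // => a _; rewrite mul0r expr0n.
have [hq _ _] := span_setJ Jq xq; have [lt _ _] := prevpP hq.
under eq_bigr do rewrite exprMn expr2 mulrC.
rewrite -mulr_suml; under eq_bigr do rewrite expr2.
rewrite sum_brick hq !mxE hq eqxx -!val_eqE /= val_prev_ord // eqxx.
by rewrite (ltn_eqF lt) (gtn_eqF lt) expr2 /=; ring.
Qed.

Lemma shiftE a : shift a = \sum_(q | J q)
  x 0 q * (if has_prev w q then linked a (prev_ord q) - linked a q else 0).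
Proof.
rewrite /shift /extra; under eq_bigr do rewrite mulr_sumr.
rewrite exchange_big; apply: eq_bigr => q _ /=.
rewrite -(sum_brick q (linked a)) mulr_sumr; apply: eq_bigr => b _; ring.
Qed.

(** At each letter at most one added cycle contributes to [shift], so squaring produces no cross
    terms and [ascending_diff] counts the straddled letters. *)
Lemma sum_shift_sqr : \sum_a shift a ^+ 2 = \sum_(q | J q) (straddle_count w q)%:R * x 0 q ^+ 2.
Proof.
transitivity (\sum_(a < size w) \sum_(q | J q) (straddles w q a)%:R * x 0 q ^+ 2).
  apply: eq_bigr => a _; rewrite shiftE sqr_sum_orth.
    apply: eq_bigr => q _; rewrite exprMn mulrC; congr (_ * _).
    case: ifP => hq; last by rewrite /straddles hq expr0n.
    by rewrite /linked val_prev_ord // ascending_diff.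
  move=> q r Jq Jr qr.
  have [->|xq] := eqVneq (x 0 q) 0; first by rewrite !mul0r.
  have [->|xr] := eqVneq (x 0 r) 0; first by rewrite !(mul0r, mulr0).
  have [hq _ _] := span_setJ Jq xq; have [hr _ _] := span_setJ Jr xr.
  rewrite hq hr /linked !val_prev_ord //.
  have sq (s : 'I_(size w)) : has_prev w s -> ~~ straddles w s a ->
      (ascending w a (prevp w s))%:R - (ascending w a s)%:R = 0 :> rat.
    by move=> hs ns; apply/eqP; rewrite -sqrf_eq0 ascending_diff // (negPf ns).
  have [sqa|/sq->//] := boolP (straddles w q a); last by rewrite mulr0 mul0r.
  have [sra|/sq->//] := boolP (straddles w r a); last by rewrite !mulr0.
  exfalso; move: sqa sra => /and4P[_ q1 q2 q3] /and4P[_ r1 r2 r3].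
  move/negP: qr; apply; apply/eqP/val_inj.
  apply: (prevp_interval_inj hq hr (a := a)); rewrite ?q1 ?r1 ?(ltnW q2) ?(ltnW r2) //.
  move: Jq Jr => /eqP Jq /eqP Jr.
  (* Two neighbours of the column of [a] differ by 0 or 2; both being [k] mod 4, they coincide. *)
  by case/orP: q3 => /eqP q3; case/orP: r3 => /eqP r3; clear -k4 Jq Jr q3 r3; lia.
rewrite exchange_big; apply: eq_bigr => q _ /=.
by rewrite -mulr_suml natr_sum.
Qed.

Lemma quad_complete_square :
  quad (- (seifert_matrix w + (seifert_matrix w)^T)) x =
  \sum_a (base a - shift a) ^+ 2 + \sum_(q | J q) (2 - (straddle_count w q)%:R) * x 0 q ^+ 2.
Proof.
rewrite quad_letter_vec letter_vec_cross.
under [X in _ = _ + X]eq_bigr do rewrite mulrBl.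
rewrite sumrB -sum_extra_sqr -sum_shift_sqr -!sumrB -big_split; apply: eq_bigr => a _ /=.
rewrite letter_vecE; have [h|h] := eqVneq (odd (nth 0%N w a)) (odd k).
  by rewrite base_supp //; ring.
by rewrite extra_supp_odd //; ring.
Qed.

End Square.

Lemma letter_vec_neq0 w (x : 'rV[rat]_(size w)) :
  (forall q : 'I_(size w), ~~ has_prev w q -> x 0 q = 0) -> x != 0 -> exists a, letter_vec x 0 a != 0.
Proof.
move=> xh; rewrite -subr_eq0 subr0 => x0.
have [i xi] : exists i, x 0 i != 0.
  by apply/existsP; apply: contraNT x0 => /existsPn h; apply/eqP/rowP => j;
    rewrite mxE; apply/eqP; rewrite -[_ == _]negbK.
(* The matrix is triangular: the letter at the last position of the support belongs to no other
   cycle of the support. *)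
have [q xq qmax] := @arg_maxnP _ i [pred j | x 0 j != 0] (fun j => nat_of_ord j) xi.
exists q; have hq : has_prev w q by apply: contraNT xq => /xh ->.
rewrite mxE (bigD1 q) //= big1 => [|r rq].
  have [lt _ _] := prevpP hq.
  rewrite mxE hq eqxx -[prev_ord q == q]val_eqE /= val_prev_ord //.
  by rewrite (ltn_eqF lt) addr0 sub0r mulf_neq0 // oppr_eq0 oner_eq0.
have [->|xr] := eqVneq (x 0 r) 0; first by rewrite mul0r.
have hr : has_prev w r by apply: contraNT xr => /xh ->.
have [lt _ _] := prevpP hr.
rewrite mxE hr (negPf rq) -[prev_ord r == q]val_eqE /= val_prev_ord // ltn_eqF ?subrr ?mulr0 //.
exact: leq_trans lt (qmax _ xr).
Qed.

Lemma quad_ge0_span_set w k par (x : 'rV[rat]_(size w)) : (k < 4)%N ->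
  (forall q, q \notin span_set w k par 2 -> x 0 q = 0) ->
  0 <= quad (- (seifert_matrix w + (seifert_matrix w)^T)) x.
Proof.
move=> k4 xs; rewrite (quad_complete_square k4 xs).
apply: addr_ge0; apply: sumr_ge0 => q; first by rewrite sqr_ge0.
move=> Jq; have [->|xq] := eqVneq (x 0 q) 0; first by rewrite expr0n mulr0.
have [_ _ le] := span_setJ xs Jq xq.
by rewrite mulr_ge0 ?sqr_ge0 // subr_ge0 ler_nat.
Qed.

Lemma quad_gt0_span_set w k par (x : 'rV[rat]_(size w)) : (k < 4)%N ->
  (forall q, q \notin span_set w k par 1 -> x 0 q = 0) -> x != 0 ->
  0 < quad (- (seifert_matrix w + (seifert_matrix w)^T)) x.
Proof.
move=> k4 xs x0; rewrite (quad_complete_square k4 xs).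
(* Either an added cycle has a nonzero coefficient and its factor [2 - D_q >= 1] gives positivity,
   or only the identity columns remain and a nonzero letter coordinate does. *)
have [/existsP[q /andP[Jq xq]]|/existsPn no] :=
  boolP [exists q : 'I_(size w), (nth 0 w q %% 4 == k)%N && (x 0 q != 0)].
  apply: ltr_wpDl; first by apply: sumr_ge0 => a _; rewrite sqr_ge0.
  rewrite (bigD1 q) //=; apply: ltr_wpDr.
    apply: sumr_ge0 => r /andP[Jr _].
    have [->|xr] := eqVneq (x 0 r) 0; first by rewrite expr0n mulr0.
    have [_ _ le] := span_setJ xs Jr xr.
    by rewrite mulr_ge0 ?sqr_ge0 // subr_ge0 ler_nat ltnW.
  have [_ _ le] := span_setJ xs Jq xq.
  by rewrite mulr_gt0 ?exprn_even_gt0 // subr_gt0 ltr_nat.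
have xJ (q : 'I_(size w)) : (nth 0 w q %% 4 == k)%N -> x 0 q = 0.
  by move=> Jq; have := no q; rewrite Jq negbK => /eqP.
have y0 a : \sum_(q < size w | (nth 0 w q %% 4 == k)%N) x 0 q * brick_mx w q a = 0.
  by apply: big1 => q /xJ ->; rewrite mul0r.
have [|a za] := letter_vec_neq0 _ x0.
  by move=> q hq; apply: xs; rewrite inE (negPf hq).
rewrite [X in _ + X]big1 => [|q /xJ ->]; last by rewrite expr0n mulr0.
rewrite addr0 (bigD1 a) //=; apply: ltr_wpDr.
  by apply: sumr_ge0 => b _; rewrite sqr_ge0.
rewrite [X in _ - X]big1 => [|b _]; last by rewrite y0 mulr0.
rewrite subr0; move: za; rewrite (letter_vecE k) y0 addr0 => za.
by rewrite exprn_even_gt0.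
Qed.

(** * Signature bounds *)

Definition seifert_sym (w : seq nat) : 'M[rat]_(size w) :=
  seifert_matrix w + (seifert_matrix w)^T.

Lemma pos_index_span_set w k par : (k < 4)%N ->
  (#|span_set w k par 1| + #|span_set w k par 2| + pos_index (seifert_sym w)
   <= size w + pos_index (- seifert_sym w))%N.
Proof.
move=> k4.
have h1 : (#|span_set w k par 1| <= pos_index (- seifert_sym w))%N.
  by apply: pos_index_geq_pos_coord => x xs x0; apply: quad_gt0_span_set xs x0.
have h2 : (pos_index (seifert_sym w) + #|span_set w k par 2| <= size w)%N.
  apply: pos_index_leq_nonpos_coord => x xs.
  have := quad_ge0_span_set k4 xs.
  by rewrite /quad mulmxN mulNmx [X in 0 <= X]mxE oppr_ge0.
lia.
Qed.

Lemma signature_bound b w : positive_braid_word b w ->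
  (size w + 16 * pos_index (seifert_sym w)
   <= 16 * pos_index (- seifert_sym w) + 19 * b)%N.
Proof.
move=> hw; set p := pos_index (seifert_sym w); set m := pos_index (- seifert_sym w).
have h8 : (\sum_(k < 4) \sum_(par : bool)
      (#|span_set w k par 1| + #|span_set w k par 2|) + 8 * p <= 8 * (size w + m))%N.
  have -> : (8 * p = \sum_(k < 4) \sum_(par : bool) p)%N.
    by rewrite !big_ord_recr big_ord0 /= !big_bool /=; lia.
  have -> : (8 * (size w + m) = \sum_(k < 4) \sum_(par : bool) (size w + m))%N.
    by rewrite !big_ord_recr big_ord0 /= !big_bool /=; lia.
  rewrite -big_split; apply: leq_sum => k _ /=.
  rewrite -big_split; apply: leq_sum => par _ /=.
  exact: pos_index_span_set.
have E : (\sum_(k < 4) \sum_(par : bool) (#|span_set w k par 1| + #|span_set w k par 2|)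
  = \sum_q \sum_(k < 4) \sum_(par : bool)
     ((q \in span_set w k par 1) + (q \in span_set w k par 2)))%N.
  rewrite [RHS]exchange_big; apply: eq_bigr => k _ /=.
  rewrite [RHS]exchange_big; apply: eq_bigr => par _ /=.
  by rewrite big_split /= !sum_bool_card; congr (_ + _)%N; apply: eq_card.
have h19 : (\sum_(q < size w) 19 * has_prev w q <= 2 * (\sum_(k < 4) \sum_(par : bool)
      (#|span_set w k par 1| + #|span_set w k par 2|)) + 2 * size w)%N.
  apply: leq_trans (leq_add (leqnn _) (sum_straddle_count w)).
  rewrite E big_distrr -big_split; apply: leq_sum => q _ /=.
  have [hq|//] := boolP (has_prev w q).
  exact: span_set_count.
have hN : (\sum_(q < size w) has_prev w q + #|first_occs w| = size w)%N.
  rewrite sum_bool_card -[RHS]card_ord -(cardC [pred q : 'I_(size w) | has_prev w q]).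
  by congr (_ + _)%N; apply: eq_card => q; rewrite !inE.
have hb := card_first_occs hw.
rewrite -big_distrr /= in h19.
(* With [l = size w], the bound follows from [X + 8 p <= 8 (l + m)], [19 Y <= 2 X + 2 l] and
   [Y >= l - b]. *)
set X := (\sum_(k < 4) _)%N in h8 h19; set Y := (\sum_(q < size w) _)%N in hN h19.
by clearbody X Y; lia.
Qed.

(** * Seifert forms of concatenated words *)

Section ConcatSeifert.
Variables v1 v2 : seq nat.

Lemma seifert_entry_catl x y : (x < size v1)%N -> (y < size v1)%N ->
  seifert_entry (v1 ++ v2) x y = seifert_entry v1 x y.
Proof. by move=> hx hy; rewrite /seifert_entry !has_prev_catl ?prevp_catl ?nth_catl. Qed.

Lemma seifert_entry_catr x y : has_prev v2 x -> has_prev v2 y ->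
  seifert_entry (v1 ++ v2) (size v1 + x) (size v1 + y) = seifert_entry v2 x y.
Proof.
move=> hx hy; rewrite /seifert_entry !has_prev_catr // hx hy /=.
by rewrite !prevp_catr // !nth_catr !eqn_add2l !ltn_add2l.
Qed.

Lemma seifert_entry_cat_cross x y : (x < size v1)%N -> has_prev v2 y ->
  seifert_entry (v1 ++ v2) x (size v1 + y) = 0 /\
  seifert_entry (v1 ++ v2) (size v1 + y) x = 0.
Proof.
move=> hx hy; rewrite /seifert_entry has_prev_catr // has_prev_catl //.
have [/prevpP[lt _ _]|] := boolP (has_prev v1 x); last by rewrite andbF.
rewrite /= prevp_catr // prevp_catl //.
set n := size v1 in hx *; set p := prevp v2 y; set q := prevp v1 x in lt *.
have -> : (x == n + y)%N = false by lia.
have -> : (n + y == x)%N = false by lia.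
have -> : (n + p == x)%N = false by lia.
have -> : (q == n + y)%N = false by lia.
have -> : (n + p < x)%N = false by lia.
have -> : (n + y < x)%N = false by lia.
have -> : (n + p < q)%N = false by lia.
by rewrite !andbF.
Qed.

(* Only the cycles at positions of v2 that are first occurrences in v2 meet v1. *)
Lemma pos_index_seifert_cat b (c : rat) : positive_braid_word b v2 ->
  (pos_index (c *: seifert_sym v1) + pos_index (c *: seifert_sym v2)
   <= pos_index (c *: seifert_sym (v1 ++ v2)) + b)%N.
Proof.
move=> hv2; have h := card_first_occs hv2.
pose e := esym (size_cat v1 v2).
apply: leq_trans (_ : _ <= pos_index (c *: seifert_sym (v1 ++ v2)) + #|first_occs v2|)%N _;
  last by rewrite leq_add2l.
apply: (@pos_index_glue _ _ _ _ _ _ (fun i => cast_ord e (lshift _ i))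
  (fun j => cast_ord e (rshift _ j))) => [i j|i j|i j].
- by rewrite !mxE /= !seifert_entry_catl.
- by rewrite !inE !negbK => hi hj; rewrite !mxE /= !seifert_entry_catr.
- rewrite inE negbK => hj; have [e1 e2] := seifert_entry_cat_cross (ltn_ord i) hj.
  by rewrite !mxE /= e1 e2 addr0 mulr0.
Qed.

End ConcatSeifert.

(** * The asymptotic signature *)

From Stdlib Require Import ZArith Reals Lra Classical.

(** * Fekete's lemma with a bounded error *)

Section Fekete.
Local Open Scope R_scope.

Lemma INR_addn (m n : nat) : INR (m + n)%nat = INR m + INR n.
Proof. exact: plus_INR. Qed.

Lemma INR_muln (m n : nat) : INR (m * n)%nat = INR m * INR n.
Proof. exact: mult_INR. Qed.

Lemma superadditive_iter (f : nat -> R) (C : R) :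
  (forall m n, f m + f n <= f (m + n)%nat) -> (forall n, - C <= f n) ->
  forall m q r, INR q * f m - C <= f (q * m + r)%nat.
Proof.
move=> sup hC m q r; elim: q => [|q IH].
  have := hC (0 * m + r)%nat; rewrite [INR 0]/=; lra.
rewrite mulSn -addnA S_INR; have := sup m (q * m + r)%nat; lra.
Qed.

Lemma fekete (a : nat -> nat) (c M : nat) :
  (forall m n, a m + a n <= a (m + n) + c)%nat -> (forall n, a n <= n * M)%nat ->
  exists L : R, Un_cv (fun n => INR (a n.+1) / INR n.+1) L.
Proof.
move=> sup bd.
(* Subtracting [c] absorbs the error and makes the sequence genuinely superadditive; the limit is
   the supremum of [f n / n]. *)
pose f n := INR (a n) - INR c.
have supf m n : f m + f n <= f (m + n)%nat.
  have /ssrnat.leP/le_INR := sup m n; rewrite !INR_addn /f; lra.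
have fC n : - INR c <= f n by rewrite /f; have := pos_INR (a n); lra.
pose E x := exists n : nat, x = f n.+1 / INR n.+1.
have pos n : 0 < INR n.+1 by exact: lt_0_INR (Nat.lt_0_succ n).
have bE : bound E.
  exists (INR M) => _ [n ->].
  apply: (Rmult_le_reg_r (INR n.+1)) => //.
  rewrite /Rdiv Rmult_assoc Rinv_l; last by have := pos n; lra.
  have /ssrnat.leP/le_INR := bd n.+1; rewrite INR_muln /f => h.
  have := pos_INR c; lra.
have [L [ub lub]] := completeness E bE (ex_intro _ _ (ex_intro _ 0%nat erefl)).
exists L => eps eps0.
have [m hm] : exists m : nat, L - eps / 2 < f m.+1 / INR m.+1.
  apply: NNPP => no; have : L <= L - eps / 2; last by lra.
  apply: lub => _ [n ->]; apply: Rnot_lt_le => h; apply: no; by exists n.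
(* [K] bounds the loss from the remainder of [n.+1] modulo [m.+1]. *)
pose K := Rabs (f m.+1) + INR c.
have K0 : 0 <= K by rewrite /K; have := Rabs_pos (f m.+1); have := pos_INR c; lra.
have [N hN] : exists N : nat, 2 * (K + INR c) / eps < INR N.
  by have [N hN] := INR_unbounded (2 * (K + INR c) / eps); exists N; lra.
exists N => n nN.
set x := INR n.+1; have x0 : 0 < x by exact: pos.
have xN : 2 * (K + INR c) < eps * x.
  have : INR N <= x by apply: le_INR; lia.
  move=> h; have h2 : 2 * (K + INR c) / eps < x by lra.
  have := Rmult_lt_compat_l eps _ _ eps0 h2.
  by rewrite /Rdiv Rmult_comm Rmult_assoc Rinv_l ?Rmult_1_r; lra.
have up : f n.+1 <= L * x.
  have := ub _ (ex_intro _ n erefl); rewrite -/x => h.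
  have := Rmult_le_compat_r x _ _ (Rlt_le _ _ x0) h.
  by rewrite /Rdiv Rmult_assoc Rinv_l; lra.
have low : (L - eps / 2) * x - K <= f n.+1.
  set t := f m.+1 / INR m.+1 in hm.
  have ft : f m.+1 = t * INR m.+1 by rewrite /t /Rdiv Rmult_assoc Rinv_l; have := pos m; lra.
  have := superadditive_iter supf fC m.+1 (n.+1 %/ m.+1) (n.+1 %% m.+1).
  rewrite -divn_eq => h.
  have ex : x = INR (n.+1 %/ m.+1) * INR m.+1 + INR (n.+1 %% m.+1).
    by rewrite -INR_muln -INR_addn -divn_eq.
  have rlt : INR (n.+1 %% m.+1) <= INR m.+1.
    by apply/le_INR/ssrnat.leP/ltnW; rewrite ltn_mod.
  have r0 := pos_INR (n.+1 %% m.+1).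
  have tr : t * INR (n.+1 %% m.+1) <= Rabs (f m.+1).
    rewrite ft Rabs_mult (Rabs_pos_eq (INR m.+1)); last by have := pos m; lra.
    apply: (Rle_trans _ (Rabs t * INR (n.+1 %% m.+1))).
      by apply: Rmult_le_compat_r => //; exact: Rle_abs.
    by apply: Rmult_le_compat_l => //; exact: Rabs_pos.
  have : (L - eps / 2) * x <= t * x by apply: Rmult_le_compat_r; lra.
  rewrite {2}ex ft in h *; rewrite /K; nra.
rewrite /R_dist; apply: Rabs_def1.
  apply: (Rmult_lt_reg_r x) => //; rewrite Rmult_minus_distr_r /Rdiv Rmult_assoc Rinv_l; last by lra.
  rewrite /f in up; have := pos_INR c; lra.
apply: (Rmult_lt_reg_r x) => //; rewrite Rmult_minus_distr_r /Rdiv Rmult_assoc Rinv_l; last by lra.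
rewrite /f in low; have := pos_INR c; nra.
Qed.

End Fekete.

(** The scalar [c] serves to treat the form ([c = 1]) and its opposite ([c = -1]) at once. *)
Lemma pos_index_pow_cvg b w (c : rat) : positive_braid_word b w ->
  exists L : R, Un_cv (fun n => (INR (pos_index (c *: seifert_sym (braid_pow w n.+1)))
                                 / INR n.+1)%R) L.
Proof.
move=> hw; apply: (@fekete (fun n => pos_index (c *: seifert_sym (braid_pow w n))) b (size w)).
  by move=> m n; rewrite braid_powD; apply/pos_index_seifert_cat/positive_braid_pow.
by move=> n; rewrite -size_braid_pow; exact: pos_index_leq.
Qed.

Lemma IZR_int_to_Z_subn (m n : nat) :
  IZR (int_to_Z (m%:Z - n%:Z)) = (INR m - INR n)%R.
Proof.
have [le|lt] := leqP n m.
  rewrite subzn //= -INR_IZR_INZ minus_INR //; exact/ssrnat.leP.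
have -> : m%:Z - n%:Z = Negz (n - m).-1 by rewrite NegzE; lia.
rewrite /int_to_Z prednK ?subn_gt0 // opp_IZR -INR_IZR_INZ minus_INR; last exact/ssrnat.leP/ltnW.
lra.
Qed.

Theorem mainTheorem3 (b : nat) (w : seq nat) (hw : positive_braid_word b w) :
  exists L : R, is_asymptotic_signature w L /\
    (- L >= INR (braid_length w) / 16)%R.
Proof.
have [Lp hp] := pos_index_pow_cvg 1 hw.
have [Lm hm] := pos_index_pow_cvg (-1) hw.
exists (Lp - Lm)%R; split.
  move=> eps eps0; have [N hN] := CV_minus _ _ _ _ hp hm eps eps0.
  exists N => n nN; have := hN n nN.
  rewrite scale1r scaleN1r /braid_signature /mx_signature -/(seifert_sym _).
  by rewrite IZR_int_to_Z_subn /Rdiv Rmult_minus_distr_r.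
apply: Rnot_lt_ge => lt.
set l := INR (braid_length w) in lt.
(* Half the supposed gap: one [eps] is spent on convergence, the other on the error [19 b / (16 n)],
   which [N'] makes small enough. *)
set eps := ((l / 16 - - (Lp - Lm)) / 2)%R.
have eps0 : (eps > 0)%R by rewrite /eps; lra.
have [N hN] := CV_minus _ _ _ _ hp hm eps eps0.
have [N' hN'] := INR_unbounded (19 * INR b / (16 * eps)).
have := hN (maxn N N') (ssrnat.leP (leq_maxl _ _)).
set n := (maxn N N').+1.
rewrite scale1r scaleN1r /R_dist => /Rabs_def2[_ h].
have /ssrnat.leP/le_INR := signature_bound (positive_braid_pow n hw).
rewrite (INR_addn (size _)) (INR_addn (muln 16 _)) !(INR_muln 16) (INR_muln 19).
have -> : INR (size (braid_pow w n)) = (INR n * l)%R by rewrite size_braid_pow INR_muln.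
set P := INR (pos_index (seifert_sym _)) in h *.
set M := INR (pos_index (- seifert_sym _)) in h *.
have n0 : (0 < INR n)%R by exact: lt_0_INR (Nat.lt_0_succ _).
have -> : INR 16 = 16%R by rewrite /=; lra.
have -> : INR 19 = 19%R by rewrite /=; lra.
have nN' : (19 * INR b < 16 * eps * INR n)%R.
  have le : (INR N' <= INR n)%R by apply/le_INR/ssrnat.leP; rewrite /n ltnW // ltnS leq_maxr.
  have h' : (19 * INR b / (16 * eps) < INR n)%R by lra.
  have := Rmult_lt_compat_l (16 * eps) _ _ ltac:(lra) h'.
  by rewrite /Rdiv Rmult_comm Rmult_assoc Rinv_l; lra.
have := Rmult_lt_compat_r _ _ _ n0 h.
rewrite !Rmult_minus_distr_r /Rdiv !Rmult_assoc Rinv_l; last by lra.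
have -> : Lp = (Lm + (2 * eps - l / 16))%R by rewrite /eps; lra.
clearbody eps; lra.
Qed.
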